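(* Let $\tau=0$ (real Ginibre ensemble) and $y>0$. For $q=2,3,4$ the random variable $\ell_{q,y}=q!\,S_y^{-q}L_q(S_y)$ has density $\gamma_{q,y}$ with respect to Lebesgue measure, where $$\gamma_{2,y}(\ell)=\frac{\sqrt2\,|y|}{\sqrt\pi\,\mathrm{erfc}(\sqrt2|y|)}\,\frac{e^{-\frac{2y^2}{3-\ell}}}{(3-\ell)^{3/2}}\,\mathbf 1_{2<\ell<3},$$ $$\gamma_{3,y}(\ell)=\frac{3\sqrt2\,|y|}{\sqrt\pi\,\mathrm{erfc}(\sqrt2|y|)}\,\frac{e^{-\frac{18y^2}{15-\ell}}}{(15-\ell)^{3/2}}\,\mathbf 1_{6<\ell<15},$$ $$\gamma_{4,y}(\ell)=\frac{\sqrt6\,|y|}{2\sqrt\pi\,\mathrm{erfc}(\sqrt2|y|)}\,\frac{e^{-\frac{6y^2}{15-\sqrt{120+\ell}}}}{\sqrt{120+\ell}\,\left(15-\sqrt{120+\ell}\right)^{3/2}}\,\mathbf 1_{24<\ell<105}.$$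
   Context: $L_q$ is the Legendre polynomial of degree $q$, defined by $\frac1{\sqrt{1-2xz+z^2}}=\sum_{q\ge0}L_q(x)z^q$. For $\tau=0$ and $y>0$, $S_y$ is a random variable distributed as a Gaussian $\mathscr N(0,1/(4y^2))$ conditioned on being greater than $1$. $\mathrm{erfc}(x)=\frac{2}{\sqrt\pi}\int_x^\infty e^{-u^2}\,\mathrm{d}u$. *)

(* Defs.v *)
From HB Require Import structures.
From mathcomp Require Import all_boot all_order all_algebra.
From mathcomp Require Import all_classical all_reals all_analysis.
From mathcomp Require Import ring lra zify.

Set Implicit Arguments.
Unset Strict Implicit.
Unset Printing Implicit Defensive.

Import Order.TTheory GRing.Theory Num.Theory.
Import numFieldNormedType.Exports.

Local Open Scope classical_set_scope.
Local Open Scope ring_scope.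

(* L_q(x) is the coefficient of z^q in the expansion of
   1 / sqrt(1 - 2xz + z^2) around z = 0, for every real x. *)
Definition legendre_family {R : realType} (L : nat -> {poly R}) : Prop :=
  forall x : R, \forall z \near (0 : R),
    series (fun q => (L q).[x] * z ^+ q) @ \oo
      --> (Num.sqrt (1 - 2 * x * z + z ^+ 2))^-1.

Section legendre_exists.
Context {R : realType}.

(* A family with this generating function exists: the polynomials (L_n, L_(n+1))
   produced by Bonnet's recursion. Their series F has positive radius of
   convergence and satisfies (1 - 2xz + z^2) F' = (x - z) F, hence
   F^2 (1 - 2xz + z^2) = 1 near 0. *)
Fixpoint bonnet (n : nat) : {poly R} * {poly R} :=
  if n is m.+1 then
    let: (p, q) := bonnet m in
    (q, (m.+2%:R)^-1 *: ((2 * m.+1 + 1)%N%:R *: ('X * q) - m.+1%:R *: p))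
  else (1, 'X).

Let a (x : R) (n : nat) : R := (bonnet n).1.[x].

Let a0 x : a x 0 = 1. Proof. by rewrite /a /= hornerC. Qed.
Let a1 x : a x 1 = x. Proof. by rewrite /a /= hornerX. Qed.
Let aS x n : n.+2%:R * a x n.+2 = (2 * n.+1 + 1)%N%:R * x * a x n.+1 - n.+1%:R * a x n.
Proof.
rewrite /a /=; case: (bonnet n) => p q /=.
rewrite !(hornerZ, hornerD, hornerN, hornerM, hornerX).
by rewrite mulVKf ?pnatr_eq0// mulrA.
Qed.

Let a_bound x n : `|a x n| <= (2 * `|x| + 1) ^+ n.
Proof.
have x0 : 0 <= `|x| by [].
set M := 2 * `|x| + 1.
have M1 : 1 <= M by rewrite /M; lra.
suff: `|a x n| <= M ^+ n /\ `|a x n.+1| <= M ^+ n.+1 by case.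
elim: n => [|n [IH1 IH2]].
  by rewrite a0 a1 expr0 expr1 normr1 /M; split => //; lra.
split=> //.
have n2 : (0 : R) < n.+2%:R by rewrite ltr0n.
rewrite -(ler_pM2l n2) -[X in X * `|_|]gtr0_norm// -normrM aS.
rewrite (le_trans (ler_normB _ _))// !normrM !normr_nat.
have Mn : 0 <= M ^+ n by rewrite exprn_ge0//; lra.
have e1 : (2 * n.+1 + 1)%N%:R <= 2 * n.+2%:R :> R.
  by rewrite -natrM ler_nat; lia.
have e2 : n.+1%:R <= n.+2%:R :> R by rewrite ler_nat.
apply: (@le_trans _ _ (2 * n.+2%:R * `|x| * M ^+ n.+1 + n.+2%:R * M ^+ n)).
  apply: lerD; last exact: ler_pM.
  by apply: ler_pM => //; rewrite ler_wpM2r.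
have -> : 2 * n.+2%:R * `|x| * M ^+ n.+1 + n.+2%:R * M ^+ n =
   n.+2%:R * (M ^+ n * (2 * `|x| * M + 1)) by rewrite exprS; ring.
have -> : M ^+ n.+2 = M ^+ n * (2 * `|x| * M + M).
  by rewrite !exprS /M; ring.
by rewrite !ler_wpM2l// lerD2l.
Qed.

Let geo (c : nat -> R) C M := forall n, `|c n| <= C * M ^+ n.

Let geo_cvg c C M z : 0 < C -> 0 < M -> geo c C M -> `|z| < M^-1 ->
  cvgn (pseries c z).
Proof.
move=> C0 M0 gc zM; apply: normed_cvg.
have Mz : 0 <= M * `|z| by rewrite mulr_ge0// ltW.
apply: (@series_le_cvg _ _ (geometric C (M * `|z|))) => [n|n|n|].
- exact: normr_ge0.
- by rewrite /geometric /=; apply: mulr_ge0; [exact: ltW|exact: exprn_ge0].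
- by rewrite /geometric /= normrM normrX exprMn mulrA ler_wpM2r// exprn_ge0.
- apply: is_cvg_geometric_series; rewrite ger0_norm//.
  by rewrite -(mulfV (lt0r_neq0 M0)) ltr_pM2l.
Qed.

Let geo_diffs c C M : 0 < C -> 0 < M -> geo c C M ->
  geo (pseries_diffs c) (C * M) (2 * M).
Proof.
move=> C0 M0 gc n; rewrite /pseries_diffs normrM normr_nat.
have -> : C * M * (2 * M) ^+ n = 2 ^+ n * (C * M ^+ n.+1).
  by rewrite exprMn exprS; ring.
apply: ler_pM => //.
by rewrite -natrX ler_nat ltn_expl.
Qed.

Let shift (c : nat -> R) n := if n is m.+1 then c m else 0.

Let cvg_shift c z l : pseries c z @ \oo --> l ->
  pseries (shift c) z @ \oo --> z * l.
Proof.
move=> cl; rewrite -cvg_shiftS.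
rewrite (_ : (fun n => _) = (fun n => z * pseries c z n)).
  exact: cvgMl_tmp.
apply/funext => n; rewrite /pseries /series /= big_nat_recl//= mul0r add0r.
by rewrite mulr_sumr; apply: eq_bigr => i _; rewrite exprS; ring.
Qed.

Section fixed_x.
Variable x : R.
Let M := 2 * `|x| + 1.
Let K := (8 * M)^-1.
Let F z := limn (pseries (a x) z).
Let dF z := limn (pseries (pseries_diffs (a x)) z).
Let Q z := 1 - 2 * x * z + z ^+ 2.

Let M0 : 0 < M. Proof. by rewrite /M ltr_wpDl// mulr_ge0. Qed.
Let K0 : 0 < K. Proof. by rewrite invr_gt0 mulr_gt0. Qed.
Let ga : geo (a x) 1 M. Proof. by move=> n; rewrite mul1r a_bound. Qed.
Let gda : geo (pseries_diffs (a x)) (1 * M) (2 * M).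
Proof. exact: geo_diffs. Qed.
Let gdda : geo (pseries_diffs (pseries_diffs (a x))) (1 * M * (2 * M)) (2 * (2 * M)).
Proof. by apply: geo_diffs => //; rewrite !mulr_gt0. Qed.

Let le_cvg c C k z : 0 < C -> 0 < k -> k < 8 -> geo c C (k * M) -> `|z| <= K ->
  cvgn (pseries c z).
Proof.
move=> C0 k0 k8 gc zK; apply: (geo_cvg C0 _ gc); first exact: mulr_gt0.
apply: (le_lt_trans zK); rewrite /K ltf_pV2 ?posrE ?mulr_gt0//.
by rewrite ltr_pM2r.
Qed.

Let cF z : `|z| <= K -> cvgn (pseries (a x) z).
Proof. by move=> zK; apply: (@le_cvg _ 1 1) => //; rewrite ?mul1r// ltr1n. Qed.
Let cdF z : `|z| <= K -> cvgn (pseries (pseries_diffs (a x)) z).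
Proof.
by move=> zK; apply: (@le_cvg _ _ 2 _ _ _ _ gda) => //; rewrite ?mul1r// ltr_nat.
Qed.
Let cddF z : `|z| <= K -> cvgn (pseries (pseries_diffs (pseries_diffs (a x))) z).
Proof.
move=> zK; apply: (@le_cvg _ (1 * M * (2 * M)) (2 * 2)) => //.
- by apply: mulr_gt0; apply: mulr_gt0.
- by lra.
- by have -> : 2 * 2 * M = 2 * (2 * M) by ring.
Qed.

Let derF z : `|z| < K -> is_derive z (1 : R) F (dF z).
Proof.
have KK : `|K| <= K by rewrite gtr0_norm.
move=> zK; apply: (@pseries_snd_diffs _ _ K); [exact: cF|exact: cdF|exact: cddF|].
by rewrite (gtr0_norm K0).
Qed.

Let ode z : `|z| < K -> Q z * dF z = (x - z) * F z.
Proof.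
move=> /ltW zK; have := cF zK; have := cdF zK.
rewrite -/(dF z) -/(F z) => cd cf.
have s1 := cvg_shift cd; have s2 := cvg_shift s1; have s3 := cvg_shift cf.
set da := pseries_diffs (a x) in cd s1 s2 *.
have lhs : (fun n => pseries da z n + - (2 * x) * pseries (shift da) z n +
    pseries (shift (shift da)) z n) @ \oo -->
    dF z + - (2 * x) * (z * dF z) + z * (z * dF z).
  by apply: cvgD s2; apply: cvgD cd _; exact: cvgMl_tmp.
have rhs : (fun n => x * pseries (a x) z n - pseries (shift (a x)) z n) @ \oo -->
    x * F z - z * F z.
  by apply: cvgB s3; exact: cvgMl_tmp.
have E : (fun n => pseries da z n + - (2 * x) * pseries (shift da) z n +
    pseries (shift (shift da)) z n) =
  (fun n => x * pseries (a x) z n - pseries (shift (a x)) z n).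
  apply/funext => n; rewrite /pseries /series /= !mulr_sumr -!big_split/= -sumrB.
  apply: eq_bigr => i _; rewrite /da /pseries_diffs.
  case: i => [|[|i]] /=.
  - by rewrite a0 a1; ring.
  - have := aS x 0; rewrite a0 a1 => ->; ring.
  - have := aS x i.+1 => ->; ring.
rewrite E in lhs.
have e := cvg_unique (@norm_hausdorff _ _) lhs rhs.
by rewrite /Q mulrBl -e; ring.
Qed.


Let G z := F z ^+ 2 * Q z.

Let derG z : `|z| < K -> is_derive z (1 : R) G 0.
Proof.
move=> zK; have dFz := derF zK.
have dQ : is_derive z (1 : R) Q (2 * z - 2 * x).
  apply: is_derive_eq; rewrite /GRing.scale /=; ring.
apply: is_derive_eq; rewrite /GRing.scale /=.
have -> : F z ^+ 2 * (2 * z - 2 * x) + Q z * (F z * dF z + F z * dF z) =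
  2 * F z * (Q z * dF z - (x - z) * F z) by ring.
by rewrite ode// subrr mulr0.
Qed.

Let F0 : F 0 = 1.
Proof.
apply: cvg_lim => //; rewrite -cvg_shiftS /=.
rewrite (_ : (fun n => _) = fun=> 1); first exact: cvg_cst.
apply/funext => n; rewrite /pseries /series /= big_nat_recl//= a0 mulr1.
by rewrite big1 ?addr0// => i _; rewrite expr0n mulr0.
Qed.

Let G1 z : `|z| < K -> G z = 1.
Proof.
move=> zK; have G0 : G 0 = 1 by rewrite /G F0 /Q; ring.
have der u : `|u| <= `|z| -> is_derive u (1 : R) G 0.
  by move=> uz; apply: derG; apply: le_lt_trans zK.
have cont u : `|u| <= `|z| -> {for u, continuous G}.
  by move=> /der du; apply/differentiable_continuous/derivable1_diffP.
have [z0|z0] := leP 0 z.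
- have sub u : u \in `[0, z] -> `|u| <= `|z|.
    by rewrite in_itv/= => /andP[u0 uz]; rewrite !ger0_norm.
  have [||c _] := @MVT_segment R G (fun=> 0) 0 z z0.
  + by move=> u uz; apply/der/sub; apply: subset_itv_oo_cc uz.
  + apply: continuous_in_subspaceT => u /set_mem uz.
    by apply: cont; apply: sub.
  + by rewrite mul0r G0 => /eqP; rewrite subr_eq0 => /eqP.
- have sub u : u \in `[z, 0] -> `|u| <= `|z|.
    by rewrite in_itv/= => /andP[u0 uz]; rewrite !ler0_norm ?lerN2// ltW.
  have [||c _] := @MVT_segment R G (fun=> 0) z 0 (ltW z0).
  + by move=> u uz; apply/der/sub; apply: subset_itv_oo_cc uz.
  + apply: continuous_in_subspaceT => u /set_mem uz.
    by apply: cont; apply: sub.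
  + by rewrite mul0r G0 => /eqP; rewrite subr_eq0 => /eqP.
Qed.

Let near_gen : \forall z \near (0 : R),
  series (fun q => a x q * z ^+ q) @ \oo --> (Num.sqrt (Q z))^-1.
Proof.
have cont0 : {for 0, continuous F}.
  have d0 : is_derive (0 : R) (1 : R) F (dF 0) by apply: derF; rewrite normr0.
  by apply/differentiable_continuous/derivable1_diffP.
have Fpos : \forall z \near (0 : R), 0 < F z.
  by apply: (cvgr_gt (F 0) cont0); rewrite F0.
have zK : \forall z \near (0 : R), `|z| < K.
  by apply: nbhs0_lt.
near=> z.
have zk : `|z| < K by near: z.
have fp : 0 < F z by near: z.
have g1 := G1 zk.
have cf : pseries (a x) z @ \oo --> F z by apply: cF; exact: ltW.
suff <- : F z = (Num.sqrt (Q z))^-1 by [].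
have -> : Q z = (F z)^-1 ^+ 2.
  have := g1; rewrite /G exprVn => e.
  apply: (mulfI (lt0r_neq0 (exprn_gt0 2 fp))).
  by rewrite e divff// expf_neq0// lt0r_neq0.
by rewrite sqrtr_sqr gtr0_norm ?invrK// invr_gt0.
Unshelve. all: by end_near. Qed.

Lemma legendre_near : \forall z \near (0 : R),
    series (fun q => (bonnet q).1.[x] * z ^+ q) @ \oo
      --> (Num.sqrt (1 - 2 * x * z + z ^+ 2))^-1.
Proof. exact: near_gen. Qed.

End fixed_x.

Lemma legendre_exists : exists L : nat -> {poly R}, legendre_family L.
Proof. by exists (fun n => (bonnet n).1) => x; exact: legendre_near. Qed.

End legendre_exists.

Definition legendre {R : realType} : nat -> {poly R} :=
  sval (cid (@legendre_exists R)).

Lemma legendreP {R : realType} : legendre_family (@legendre R).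
Proof. exact: svalP (cid (@legendre_exists R)). Qed.

Definition erfc {R : realType} (x : R) : R :=
  2 / Num.sqrt pi * \int[lebesgue_measure]_(u in `[x, +oo[) expR (- u ^+ 2).

Definition conditioned {R : realType} (mu : set R -> \bar R) (B A : set R) : \bar R :=
  (mu (A `&` B) / mu B)%E.

(* normal_prob takes the standard deviation, here sqrt(1 / (4 y^2)). *)
Definition is_S {d : measure_display} {T : measurableType d} {R : realType}
    {P : probability T R} (y : R) (S : {RV P >-> R}) : Prop :=
  forall A : set R, measurable A ->
    distribution P S A =
    conditioned (normal_prob 0 (Num.sqrt (1 / (4 * y ^+ 2)))) `]1, +oo[ A.

Definition ell {T : Type} {R : realType} (q : nat) (S : T -> R) (w : T) : R :=
  q`!%:R * S w ^- q * (legendre q).[S w].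

Definition has_density {d : measure_display} {T : measurableType d}
    {R : realType} (P : probability T R) (X : T -> R) (f : R -> R) : Prop :=
  [/\ measurable_fun setT X, measurable_fun setT f, (forall x, 0 <= f x)
    & forall A : set R, measurable A ->
        P (X @^-1` A) = (\int[lebesgue_measure]_(x in A) (f x)%:E)%E].

Section densities.
Context {R : realType}.
Implicit Types y l : R.

Definition gamma2 y l : R :=
  Num.sqrt 2 * `|y| / (Num.sqrt pi * erfc (Num.sqrt 2 * `|y|))
  * (expR (- (2 * y ^+ 2 / (3 - l))) / (3 - l) `^ (3 / 2))
  * \1_(`]2, 3[%classic) l.

Definition gamma3 y l : R :=
  3 * Num.sqrt 2 * `|y| / (Num.sqrt pi * erfc (Num.sqrt 2 * `|y|))
  * (expR (- (18 * y ^+ 2 / (15 - l))) / (15 - l) `^ (3 / 2))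
  * \1_(`]6, 15[%classic) l.

Definition gamma4 y l : R :=
  Num.sqrt 6 * `|y| / (2 * Num.sqrt pi * erfc (Num.sqrt 2 * `|y|))
  * (expR (- (6 * y ^+ 2 / (15 - Num.sqrt (120 + l))))
     / (Num.sqrt (120 + l) * (15 - Num.sqrt (120 + l)) `^ (3 / 2)))
  * \1_(`]24, 105[%classic) l.

End densities.

(* Main.v *)
(* The generating function determines the Legendre polynomials (a power series
   vanishing near 0 has zero coefficients), and Bonnet's recursion gives, with
   u = s^-2, q! s^-q L_q(s) = 3 - u, 15 - 9u, 105 - 90u + 9u^2 for q = 2, 3, 4.
   Each is a decreasing function of u in ]0, 1[ with an explicit inverse, so the
   density is obtained by changing variables in P(ell < l) for l below the
   supremum of the support, and laws on R are determined by such rays. The peak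
   of the Gaussian cancels in the conditioning, leaving the constant
   1 / \int_1^oo exp(-2 y^2 s^2) ds = 2 sqrt2 y / (sqrt pi erfc(sqrt2 y)). *)
From HB Require Import structures.
Require Import Defs.
From mathcomp Require Import all_boot all_order all_algebra.
From mathcomp Require Import all_classical all_reals all_analysis.
From mathcomp Require Import measurable_realfun ring lra.

Set Implicit Arguments.
Unset Strict Implicit.
Unset Printing Implicit Defensive.

Import Order.TTheory GRing.Theory Num.Theory.
Import numFieldNormedType.Exports.

Local Open Scope classical_set_scope.
Local Open Scope ring_scope.

(** * Uniqueness of the coefficients of a power series *)

Lemma sum_half_pow_le2 (R : realFieldType) n : \sum_(0 <= i < n) 2^-1 ^+ i <= 2 :> R.
Proof.
suff -> : \sum_(0 <= i < n) 2^-1 ^+ i = 2 - 2 * 2^-1 ^+ n :> R.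
  by rewrite lerBlDr lerDl mulr_ge0// exprn_ge0// invr_ge0.
elim: n => [|n IH]; first by rewrite big_nil expr0; ring.
by rewrite big_nat_recr//= IH exprS; field.
Qed.

Section pseries_eq0.
Context {R : realType}.
Implicit Type c : nat -> R.

(** Where the series sums to 0, [c 0] is minus the sum of the later terms, and these carry a factor
    [z]: their sum is O(z), so letting [z] tend to 0 from the right gives [c 0 = 0]. *)
Lemma pseries_eq0_coef0 c :
  (\forall z \near (0 : R)^'+, series (fun q => c q * z ^+ q) @ \oo --> (0 : R)) ->
  c 0%N = 0.
Proof.
move=> c0.
(* Half the radius of the neighbourhood, so that the endpoint [z = r] is itself a point of
   convergence. *)
have [r r0 cr] : exists2 r : R, 0 < r &
    forall z, 0 < z -> z <= r -> series (fun q => c q * z ^+ q) @ \oo --> (0 : R).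
  case: c0 => e /= e0 ce; exists (e / 2); first by rewrite divr_gt0.
  move=> z z0 ze; apply: ce => //=; rewrite sub0r normrN gtr0_norm//; lra.
(* The terms of the convergent series at [r] tend to 0, hence are bounded. *)
have [B B0 cB] : exists2 B, 0 < B & forall q, `|c q| * r ^+ q <= B.
  have /cvg_series_cvg_0 := cvgP _ (cr r r0 (lexx r)).
  move=> /cvgP/cvg_seq_bounded/pinfty_ex_gt0[B B0 BP].
  exists B => // q; have := BP q I => /=.
  by rewrite normrM (ger0_norm (exprn_ge0 _ (ltW r0))).
(* For [z <= r / 2] the bound at [r] gives [|c i.+1| * z ^+ i <= B / r * 2^-1 ^+ i], and the
   geometric sum contributes the factor 2. *)
have cz z : 0 < z -> z <= r / 2 -> `|c 0%N| <= z * (2 * (B / r)).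
  move=> z0 zr; have zr' : z <= r by lra.
  have /cvgN := cr z z0 zr'; rewrite -cvg_shiftS oppr0.
  move=> /(cvgD (cvg_cst (c 0%N))); rewrite addr0 => /cvg_norm lim.
  apply: (cvgr_to_le lim); apply: nearW => n.
  rewrite /= !fctE /series /= big_nat_recl//= expr0 mulr1 opprD addrA subrr add0r normrN.
  under eq_bigr => i _ do rewrite exprS mulrCA.
  rewrite -mulr_sumr normrM (gtr0_norm z0) ler_pM2l//.
  apply: (le_trans (ler_norm_sum _ _ _)).
  apply: (@le_trans _ _ (\sum_(0 <= i < n) B / r * 2^-1 ^+ i)); last first.
    rewrite -mulr_sumr mulrC ler_wpM2r ?sum_half_pow_le2//.
    by rewrite divr_ge0// ltW.
  apply: ler_sum => i _; rewrite normrM (ger0_norm (exprn_ge0 _ (ltW z0))).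
  apply: (@le_trans _ _ (`|c i.+1| * (r / 2) ^+ i)).
    by rewrite ler_wpM2l// lerXn2r// nnegrE ?divr_ge0// ltW.
  rewrite exprMn mulrA ler_wpM2r ?exprn_ge0 ?invr_ge0// ler_pdivlMr//.
  by rewrite -mulrA -exprSr.
apply/normr0_eq0/eqP; rewrite eq_le normr_ge0 andbT.
have lim : (fun z : R => z * (2 * (B / r))) z @[z --> 0^'+] --> (0 : R).
  rewrite -[X in _ --> X](mul0r (2 * (B / r))).
  by apply: cvgMr_tmp; apply: cvg_at_right_filter; exact: cvg_id.
apply: (cvgr_to_ge lim); near=> z; apply: cz; first by near: z; exact: nbhs_right_gt.
near: z; apply: nbhs_right_le; exact: divr_gt0.
Unshelve. all: by end_near. Qed.

(** Once [c 0] vanishes, dividing by [z] shows that the shifted coefficients satisfy the same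
    hypothesis. This division is why only positive [z] near 0 are considered. *)
Lemma pseries_eq0_coef c :
  (\forall z \near (0 : R)^'+, series (fun q => c q * z ^+ q) @ \oo --> (0 : R)) ->
  forall n, c n = 0.
Proof.
move=> c0 n; elim: n c c0 => [|n IH] c c0; first exact: pseries_eq0_coef0.
apply: (IH (fun q => c q.+1)); near=> z.
have z0 : 0 < z by near: z; exact: nbhs_right_gt.
have : series (fun q => c q * z ^+ q) @ \oo --> (0 : R) by near: z.
rewrite -cvg_shiftS => /(@cvgMl_tmp _ _ _ _ _ z^-1); rewrite mulr0.
apply: cvg_trans; apply: near_eq_cvg; apply: nearW => k.
rewrite /series /= big_nat_recl//= (pseries_eq0_coef0 c0) mul0r add0r mulr_sumr.
by apply: eq_bigr => i _; rewrite exprS mulrCA mulKf// gt_eqF.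
Unshelve. all: by end_near. Qed.

End pseries_eq0.

(** * Explicit Legendre polynomials of degree 2, 3 and 4 *)

(** [legendre] comes from a choice and does not compute; having the same generating function as
    Bonnet's recursion, it inherits the values of the latter. *)
Lemma legendreE {R : realType} q (x : R) : (legendre q).[x] = (bonnet q).1.[x].
Proof.
apply/eqP; rewrite -subr_eq0; apply/eqP; move: q.
apply: (@pseries_eq0_coef _ (fun q => (legendre q).[x] - (bonnet q).1.[x])).
suff : \forall z \near (0 : R),
    series (fun q => ((legendre q).[x] - (bonnet q).1.[x]) * z ^+ q) @ \oo --> (0 : R).
  by apply: filterS.
near=> z.
have cl : series (fun q => (legendre q).[x] * z ^+ q) @ \oo -->
    (Num.sqrt (1 - 2 * x * z + z ^+ 2))^-1 by near: z; exact: (legendreP x).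
have cb : series (fun q => (bonnet q).1.[x] * z ^+ q) @ \oo -->
    (Num.sqrt (1 - 2 * x * z + z ^+ 2))^-1 by near: z; exact: legendre_near.
rewrite (_ : series _ = series (fun q => (legendre q).[x] * z ^+ q) -
    series (fun q => (bonnet q).1.[x] * z ^+ q)); last first.
  apply/funext => n; rewrite fctE /series /= -sumrB.
  by apply: eq_bigr => i _; rewrite mulrBl.
rewrite -(subrr (Num.sqrt (1 - 2 * x * z + z ^+ 2))^-1).
exact: (@cvgB _ _ _ _ _ _ _ _ _ cl cb).
Unshelve. all: by end_near. Qed.

Lemma legendre2E {R : realType} (x : R) : (legendre 2).[x] = (3 * x ^+ 2 - 1) / 2.
Proof. by rewrite legendreE /= !hornerE/=; field. Qed.

Lemma legendre3E {R : realType} (x : R) :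
  (legendre 3).[x] = (5 * x ^+ 3 - 3 * x) / 2.
Proof. by rewrite legendreE /= !hornerE/=; field. Qed.

Lemma legendre4E {R : realType} (x : R) :
  (legendre 4).[x] = (35 * x ^+ 4 - 30 * x ^+ 2 + 3) / 8.
Proof. by rewrite legendreE /= !hornerE/=; field. Qed.

(** * Densities on the line, characterised by open left rays *)

Section density.
Context {d : measure_display} {T : measurableType d} {R : realType}.
Notation mu := (@lebesgue_measure R).

(** [powR] with exponent -1 is the inverse on nonnegative bases, whence the square; at 0 both sides
    are 0 by convention. *)
Lemma measurable_invr : measurable_fun setT (@GRing.inv R).
Proof.
rewrite (_ : GRing.inv = fun x : R => x * (x ^+ 2) `^ (-1)); last first.
  apply/funext => x; rewrite powR_inv1 ?sqr_ge0//.
  have [->|x0] := eqVneq x 0; first by rewrite invr0 mul0r.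
  by rewrite expr2 invfM mulVKf.
apply: measurable_funM => //.
by apply: (measurableT_comp (measurable_powR _)); exact: measurable_funX.
Qed.

Lemma eq_integral_support (A B : set R) (f : R -> \bar R) :
  (forall x, f x != 0%E -> A x <-> B x) ->
  (\int[mu]_(x in A) f x = \int[mu]_(x in B) f x)%E.
Proof.
move=> AB; rewrite integral_mkcond [RHS]integral_mkcond; congr integral.
apply/funext => x; rewrite !patchE; have [f0|/AB ABx] := eqVneq (f x) 0%E.
  by rewrite f0 !if_same.
by rewrite (_ : x \in A = (x \in B))//; apply/idP/idP; rewrite !inE => /ABx.
Qed.

(** Both sides are measures in [A]. They agree on the open left rays, a generating family closed
    under intersection, and are finite on the rays []-oo, n[] that exhaust the line. *)
Lemma has_density_lt (P : probability T R) (X : T -> R) (f : R -> R) :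
  measurable_fun setT X -> measurable_fun setT f -> (forall x, 0 <= f x) ->
  (forall l, P (X @^-1` `]-oo, l[) = (\int[mu]_(x in `]-oo, l[) (f x)%:E)%E) ->
  has_density P X f.
Proof.
move=> mX mf f0 Xf; split=> // A mA.
pose Y : {mfun T >-> R} := HB.pack X (isMeasurableFun.Build _ _ _ _ X mX).
have mEf : measurable_fun setT (EFin \o f) by exact/measurable_EFinP.
have Ef0 x : (0 <= (EFin \o f) x)%E by rewrite lee_fin.
pose nu (A : set R) := (\int[mu]_(x in A) (f x)%:E)%E.
have nu0 : nu set0 = 0%E by exact: integral_set0.
have nu_ge0 B : (0 <= nu B)%E by apply: integral_ge0 => x _; exact: Ef0.
have nu_sigma : semi_sigma_additive nu.
  exact: (semi_sigma_additive_nng_induced (mu := mu) mEf Ef0).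
pose nuM := isMeasure.Build _ _ R nu nu0 nu_ge0 nu_sigma.
pose nu' : {measure set R -> \bar R} := HB.pack nu nuM.
pose m1 : {measure set R -> \bar R} := distribution P Y.
apply: (@measure_unique _ R _ (@RGenInftyO.G R)
  (fun n => `]-oo, n%:R[%classic) _ _ _ _ m1 nu' _ _ A mA).
- exact: RGenInftyO.measurableE.
- move=> _ _ [x ->] [y ->]; exists (Num.min x y); rewrite predeqE => z.
  by rewrite /= !in_itv/= lt_min; split => [[-> ->]|/andP].
- by move=> n; exists n%:R.
- rewrite predeqE => x; split => // _.
  exists (Num.bound `|x|) => //=; rewrite in_itv/=.
  by rewrite (le_lt_trans (ler_norm x))// archi_boundP.
- by move=> _ [l ->]; exact: Xf.
- move=> n; rewrite (@le_lt_trans _ _ 1%E) ?ltry//; exact: probability_le1.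
Qed.

(* The value at the right end of the support is recovered by continuity from
   below, which spares an improper change of variables there. *)
Lemma has_density_lt_sup (P : probability T R) (X : T -> R) (f : R -> R) (b : R) :
  measurable_fun setT X -> measurable_fun setT f -> (forall x, 0 <= f x) ->
  P (X @^-1` `]-oo, b[) = 1%E -> (forall l, b <= l -> f l = 0) ->
  (forall l, l < b ->
    P (X @^-1` `]-oo, l[) = (\int[mu]_(x in `]-oo, l[) (f x)%:E)%E) ->
  has_density P X f.
Proof.
move=> mX mf f0 Pb fb Xf; apply: has_density_lt => // l.
have mpre B : measurable B -> measurable (X @^-1` B).
  by move=> mB; rewrite -(setTI (_ @^-1` _)); exact: mX.
have [lb|bl] := ltP l b; first exact: Xf.
have -> : P (X @^-1` `]-oo, l[) = 1%E.
  apply/eqP; rewrite eq_le; apply/andP; split; first exact/probability_le1/mpre.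
  rewrite -Pb le_measure// ?inE; [exact: mpre..|].
  by move=> w; rewrite /= !in_itv/= => /lt_le_trans; exact.
(* Nothing is integrated from [b] on, so the claim is that the integral below [b] is 1; it is
   reached along the rays ending at [b - 1 / (n + 1)]. *)
rewrite (@eq_integral_support _ `]-oo, b[); last first.
  move=> x fx; rewrite /= !in_itv/=; split => [_|xb]; last exact: lt_le_trans bl.
  by rewrite ltNge; apply: contra fx => /fb ->.
rewrite -Pb.
pose F n := `]-oo, b - n.+1%:R^-1[%classic.
have bF : `]-oo, b[%classic = \bigcup_n F n.
  rewrite predeqE => x; split => [|[n _]].
    rewrite /= in_itv/= => /ltr_add_invr[n xn]; exists n => //.
    by rewrite /F/= in_itv/= ltrBrDr.
  by rewrite /F/= !in_itv/= => /lt_le_trans; apply; rewrite gerBl invr_ge0.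
have nF : {homo F : n m / (n <= m)%N >-> (n <= m)%O}.
  move=> n m nm; rewrite subsetEset => x; rewrite /F/= !in_itv/= => /lt_le_trans.
  by apply; rewrite lerB// lef_pV2 ?posrE// ler_nat.
have mEf : measurable_fun setT (EFin \o f) by exact/measurable_EFinP.
rewrite bF preimage_bigcup.
have nP : {homo (fun n => X @^-1` F n) : n m / (n <= m)%N >-> (n <= m)%O}.
  move=> n m /nF; rewrite !subsetEset => nm; exact: preimage_subset.
have mP n : measurable (X @^-1` F n) by apply: mpre; exact: measurable_itv.
have cP : P (X @^-1` F n) @[n --> \oo] --> P (\bigcup_n X @^-1` F n).
  by apply: nondecreasing_cvg_mu => //; exact: bigcupT_measurable.
have cf : (\int[mu]_(x in F n) (f x)%:E)%E @[n --> \oo] -->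
    (\int[mu]_(x in \bigcup_n F n) (f x)%:E)%E.
  apply: ge0_nondecreasing_set_cvg_integral => //.
  - by move=> n; exact: measurable_itv.
  - by move=> n; exact: measurable_funTS.
  - by move=> n x _; rewrite lee_fin.
rewrite -(cvg_lim _ cP)// -(cvg_lim _ cf)//; apply: congr_lim.
apply/funext => n; apply: Xf.
by rewrite ltrBlDr ltrDl invr_gt0.
Qed.

End density.

(** * Change of variables under an increasing map *)

Section increasing_comp.
Context {d : measure_display} {T : measurableType d} {R : realType}.
Notation mu := (@lebesgue_measure R).
Context (P : probability T R) (S : {RV P >-> R}).

(** [h] inverts [g] on [[a, b[], so for [a < l < b] the event [g S < l] is [c < S < h l] up to a
    null set, and the substitution [s = h x] carries the integral over []c, h l[] to []a, l[].
    Differentiability of [h] at [a] itself provides the limit of the derivative at the left end. *)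
Lemma has_density_increasing_comp (p g h dh f : R -> R) (a b c : R) :
  continuous p ->
  (forall A, measurable A ->
    P (S @^-1` A) = (\int[mu]_(s in A `&` `]c, +oo[) (p s)%:E)%E) ->
  measurable_fun setT g -> {in `[c, +oo[ &, {homo g : s t / s < t}} ->
  g c = a -> (forall s, c < s -> g s < b) ->
  {in `[a, b[, forall l, c <= h l} -> {in `[a, b[, forall l, g (h l) = l} ->
  {in `[a, b[, forall l, is_derive l (1 : R) h (dh l)} ->
  {in `[a, b[, continuous dh} ->
  measurable_fun setT f -> (forall l, 0 <= f l) ->
  {in `]a, b[, forall l, f l = p (h l) * dh l} ->
  (forall l, l \notin `]a, b[ -> f l = 0) ->
  has_density P (g \o S) f.
Proof.
move=> cp Sp mg gincr gca gb ch gh hdh cdh mf f0 fab fN.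
have gincrW s t : c <= s -> c <= t -> (g s < g t) = (s < t).
  move=> cs ct; have [st|ts|->] := ltgtP s t; last by rewrite ltxx.
  - by rewrite gincr// in_itv/= ?cs ?ct.
  - by apply/negbTE; rewrite -leNgt ltW// gincr// in_itv/= ?cs ?ct.
have mlt l : measurable (g @^-1` `]-oo, l[).
  by rewrite -(setTI (_ @^-1` _)); apply: mg => //; exact: measurable_itv.
apply: (@has_density_lt_sup _ _ _ _ _ _ b) => //.
- exact: measurableT_comp.
(* No integral is computed: on []c, +oo[] the constraint [g s < b] always holds, so this is the
   integral for the whole space, which is 1. *)
- rewrite comp_preimage Sp// -[RHS](@probability_setT _ _ _ P).
  rewrite -(preimage_setT S) Sp//; congr (integral _ _ _).
  rewrite predeqE => s; split => [[_ ?]//|[_ cs]]; split => //.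
  by move: cs; rewrite /= !in_itv/= andbT => /gb.
- by move=> l bl; apply: fN; rewrite in_itv/= negb_and -!leNgt bl orbT.
move=> l lb; rewrite comp_preimage Sp//.
have [la|al] := leP l a.
  rewrite (_ : _ `&` _ = set0); last first.
    rewrite predeqE => s; split => // -[].
    rewrite /= !in_itv/= andbT => gsl cs.
    have := lt_le_trans gsl la; rewrite -gca gincrW ?lexx ?(ltW cs)// => sc.
    by have := lt_trans sc cs; rewrite ltxx.
  rewrite integral_set0 (@eq_integral_support _ _ set0) ?integral_set0// => x fx.
  split=> //=; rewrite in_itv/= => xl; move: fx; rewrite fN ?eqxx//.
  by rewrite in_itv/= negb_and -!leNgt (ltW (lt_le_trans xl la)).
have lab : l \in `[a, b[ by rewrite in_itv/= ltW.
have aab : a \in `[a, b[ by rewrite in_itv/= lexx (lt_trans al).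
have sub x : x \in `[a, l] -> x \in `[a, b[.
  by rewrite !in_itv/= => /andP[-> /le_lt_trans]; exact.
have subo x : x \in `]a, l[ -> x \in `[a, b[.
  by move=> /subset_itv_oo_cc/sub.
have hac : h a = c.
  apply/eqP; rewrite eq_le ch// andbT leNgt -gincrW ?ch//.
  by rewrite gh// gca ltxx.
have hincr : {in `[a, l] &, {homo h : x y / x < y}}.
  by move=> x y /sub xab /sub yab xy; rewrite -gincrW ?ch// !gh.
have hE x : x \in `[a, b[ -> (h^`())%classic x = dh x.
  by move=> /hdh dx; rewrite derive1E derive_val.
have ch' x : x \in `[a, b[ -> {for x, continuous h}.
  by move=> /hdh dx; apply/differentiable_continuous/derivable1_diffP.
have near_dh x : x \in `]a, l[ -> \forall z \near x, dh z = (h^`())%classic z.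
  move=> xal; near=> z; rewrite hE// subo//.
  by near: z; exact: near_in_itvoo.
rewrite (_ : _ `&` _ = `]h a, h l[%classic); last first.
  rewrite hac predeqE => s; rewrite /= !in_itv/= andbT.
  split => [[gsl cs]|/andP[cs shl]].
    by rewrite cs/= -gincrW ?gh ?ch// ltW.
  by rewrite cs -[l]gh// gincrW ?ch// ltW.
(* The substitution theorem is applied on closed intervals; the endpoints are negligible. *)
rewrite -(@integral_itv_bndoo _ _ _ _ true false); last first.
  apply/measurable_EFinP/measurable_funTS; exact: continuous_measurable_fun.
rewrite (@integration_by_substitution_increasing _ h p a l)//; first last.
- exact: continuous_subspaceT.
- split; first by move=> x /subo/hdh[].
  + by apply: cvg_at_right_filter; exact: ch'.
  + by apply: cvg_at_left_filter; exact: ch'.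
(* The derivative of [h] is known to be [dh] on [[a, b[] only, so its one-sided limits are those of
   [dh], transferred by equality near the endpoint. *)
- apply/cvg_ex; exists (dh l).
  apply: (@cvg_trans _ (dh x @[x --> l^'-])); last first.
    by apply: cvg_at_left_filter; exact: cdh.
  apply: near_eq_cvg; near=> z; rewrite hE// subo// in_itv/=.
  by apply/andP; split; near: z; [exact: nbhs_left_gt|exact: nbhs_left_lt].
- apply/cvg_ex; exists (dh a).
  apply: (@cvg_trans _ (dh x @[x --> a^'+])); last first.
    by apply: cvg_at_right_filter; exact: cdh.
  apply: near_eq_cvg; near=> z; rewrite hE// subo// in_itv/=.
  by apply/andP; split; near: z; [exact: nbhs_right_gt|exact: nbhs_right_lt].
- move=> x xal; rewrite /continuous_at hE ?subo//.
  apply: (@cvg_trans _ (dh z @[z --> x])); last exact/cdh/subo.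
  by apply: near_eq_cvg; exact: near_dh.
- exact: ltW.
have fE x : x \in `]a, l[ -> f x = ((p \o h) * (h^`())%classic)%R x.
  move=> xal; rewrite fab; last first.
    by move: xal; rewrite !in_itv/= => /andP[-> /lt_trans]; exact.
  by rewrite fctE/= hE ?subo.
rewrite integral_itv_bndoo; last first.
  apply/measurable_EFinP; apply: (@eq_measurable_fun _ _ _ _ _ f).
    by move=> x; rewrite inE => /fE.
  exact: measurable_funTS.
rewrite [RHS](@eq_integral_support _ _ `]a, l[); last first.
  move=> x fx; rewrite /= !in_itv/=; split => [xl|/andP[]//].
  rewrite xl andbT ltNge; apply: contra fx => xa.
  by rewrite fN// in_itv/= negb_and -leNgt xa.
by apply: eq_integral => x; rewrite inE => /fE ->.
Unshelve. all: by end_near. Qed.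

End increasing_comp.

(** * The law of the conditioned Gaussian as an explicit integral *)

Section conditioned_normal.
Context {R : realType}.
Notation mu := (@lebesgue_measure R).

Lemma continuous_expRNsqr (k : R) : continuous (fun x : R => expR (- (k * x ^+ 2))).
Proof.
move=> x; apply: continuous_comp; last exact: continuous_expR.
by apply: cvgN; apply: cvgMl_tmp; exact: exprn_continuous.
Qed.

(** Substitution [u = k * x]. With [k = sqrt 2 * y] it moves the integral of [erfc] to the
    conditioning half-line. *)
Lemma integral_expRNsqr_scale (k : R) : 0 < k ->
  (\int[mu]_(u in `[k, +oo[) (expR (- u ^+ 2))%:E =
   k%:E * \int[mu]_(x in `]1%R, +oo[) (expR (- (k ^+ 2 * x ^+ 2)))%:E)%E.
Proof.
move=> k0; pose F (x : R) := k * x.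
have dF x : is_derive x (1 : R) F k.
  by apply: is_derive_eq; rewrite /GRing.scale /= mulr1.
have F'E : (F^`())%classic = cst k.
  by apply/funext => x; rewrite derive1E derive_val.
have mE : measurable_fun setT (fun x : R => (expR (- (k ^+ 2 * x ^+ 2)))%:E).
  by apply/measurable_EFinP; apply: continuous_measurable_fun; exact: continuous_expRNsqr.
have cF : continuous F.
  by move=> x; apply/differentiable_continuous/derivable1_diffP; case: (dF x).
transitivity (\int[mu]_(u in `[F 1%R, +oo[) (expR (- u ^+ 2))%:E)%E.
  by rewrite /F mulr1.
rewrite (@increasing_ge0_integration_by_substitutiony _ F)//.
- rewrite integral_itv_obnd_cbnd; last exact: measurable_funTS.
  rewrite -ge0_integralZl_EFin ?(ltW k0)//; last exact: measurable_funTS.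
  apply: eq_integral => x _; rewrite fctE /= F'E /F exprMn -EFinM.
  by rewrite mulrC.
- by move=> x z _ _ xz; rewrite /F ltr_pM2l.
- by rewrite F'E => x _; exact: cvg_cst.
- by rewrite F'E; exact: is_cvg_cst.
- by rewrite F'E; exact: is_cvg_cst.
- split; first by move=> x _; case: (dF x).
  by apply: cvg_at_right_filter; exact: cF.
- by apply: gt0_cvgMry => //; exact: cvg_id.
- apply: continuous_subspaceT => x.
  by have := @continuous_expRNsqr 1 x; under eq_fun do rewrite mul1r.
Qed.

Lemma is_S_preimage {d : measure_display} {T : measurableType d}
    (P : probability T R) (y : R) (S : {RV P >-> R}) : 0 < y -> is_S y S ->
  forall A, measurable A -> P (S @^-1` A) =
    (\int[mu]_(s in A `&` `]1%R, +oo[)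
      (2 * Num.sqrt 2 * y / (Num.sqrt pi * erfc (Num.sqrt 2 * y)) *
       expR (- (2 * y ^+ 2 * s ^+ 2)))%:E)%E.
Proof.
move=> y0 Sy A mA.
set sigma := Num.sqrt (1 / (4 * y ^+ 2)).
have y2 : 0 < y ^+ 2 by rewrite exprn_gt0.
have s0 : 0 < sigma by rewrite sqrtr_gt0 divr_gt0// mulr_gt0.
have s2 : sigma ^+ 2 = 1 / (4 * y ^+ 2).
  by rewrite sqr_sqrtr// divr_ge0// mulr_ge0// ltW.
pose e s : R := expR (- (2 * y ^+ 2 * s ^+ 2)).
have e0 s : 0 <= e s by exact: expR_ge0.
have me : measurable_fun setT e.
  by apply: continuous_measurable_fun; exact: continuous_expRNsqr.
pose c := normal_peak sigma.
have c0 : 0 < c by rewrite normal_peak_gt0// gt_eqF.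
pose I B := (\int[mu]_(s in B) (e s)%:E)%E.
pose N := normal_prob 0 sigma.
have NE B : measurable B -> N B = (c%:E * I B)%E.
  move=> mB; rewrite -ge0_integralZl_EFin//.
  - apply: eq_integral => s _; rewrite normal_pdfE ?gt_eqF// /c EFinM; congr (_ * (expR _)%:E)%E.
    by rewrite subr0 s2; field; rewrite gt_eqF.
  - by move=> s _; rewrite lee_fin.
  - by apply/measurable_EFinP; exact: measurable_funTS.
  - exact: ltW.
pose D : set R := `]1, +oo[%classic.
have mD : measurable D by exact: measurable_itv.
have PN B : measurable B -> P (S @^-1` B) = (N (B `&` D) / N D)%E.
  by move=> mB; exact: Sy.
(* If the conditioning event were null, the quotient would give the whole space mass 0,
   contradicting that [P] is a probability. *)
have NB0 : N D != 0%E.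
  apply/eqP => N0; have := PN setT measurableT.
  rewrite preimage_setT probability_setT setTI N0 mul0e => /eqP.
  by rewrite eqe oner_eq0.
(* Finiteness follows from [N D <= 1] and the positivity of the peak [c], nonvanishing from
   [N D != 0]. *)
have [r IB r0] : exists2 r, I D = r%:E & r != 0.
  have : (I D \is a fin_num).
    have I0 : (0 <= I D)%E.
      by apply: integral_ge0 => s _; rewrite lee_fin.
    rewrite ge0_fin_numE// ltey; apply/eqP => Ioo.
    have : (N D <= 1)%E by exact: (probability_le1 (normal_prob 0 sigma) mD).
    by rewrite NE// Ioo gt0_muley ?lte_fin// leye_eq.
  move=> /fineK IB; exists (fine (I D)); first by rewrite IB.
  by apply: contra NB0 => /eqP r0; rewrite NE// -IB r0 mule0.
(* By scaling, [erfc (sqrt 2 * y)] is [2 / sqrt pi * (sqrt 2 * y) * r]. *)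
have -> : 2 * Num.sqrt 2 * y / (Num.sqrt pi * erfc (Num.sqrt 2 * y)) = r^-1.
  have k0 : 0 < Num.sqrt 2 * y by rewrite mulr_gt0// sqrtr_gt0.
  rewrite /erfc /Rintegral integral_expRNsqr_scale//.
  have -> : (Num.sqrt 2 * y) ^+ 2 = 2 * y ^+ 2 by rewrite exprMn sqr_sqrtr.
  rewrite -/(I _) IB /=.
  field.
  by rewrite r0 !gt_eqF ?sqrtr_gt0 ?pi_gt0.
rewrite PN// !NE//; last exact: measurableI.
rewrite IB -EFinM inver mulf_eq0 gt_eqF//= (negbTE r0).
under eq_integral do rewrite EFinM.
have r_ge0 : 0 <= r by rewrite -lee_fin -IB integral_ge0// => s _; rewrite lee_fin.
have mAD : measurable (A `&` D) by exact: measurableI.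
rewrite ge0_integralZl_EFin ?invr_ge0//; last first.
  by apply/measurable_EFinP; exact: measurable_funTS.
by rewrite -/(I _) muleAC -EFinM invfM mulrA divff ?gt_eqF// mul1r.
Qed.

End conditioned_normal.

(** * Decreasing functions of the inverse square *)

Section truncated_gaussian.
Context {d : measure_display} {T : measurableType d} {R : realType}.
Context (P : probability T R) (y : R) (S : {RV P >-> R}).
Hypotheses (y0 : 0 < y) (Sy : is_S y S).

Lemma has_density_decreasing_inv_sqr (g G r dr f : R -> R) (a b k : R) :
  0 < k ->
  measurable_fun setT g -> (forall s, 1 <= s -> g s = G (s ^- 2)) ->
  {in `]0, 1] &, {homo G : u v /~ u < v}} ->
  G 1 = a -> {in `]0, 1[, forall u, G u < b} ->
  {in `[a, b[, forall l, 0 < r l <= k ^+ 2} ->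
  {in `[a, b[, forall l, G (r l / k ^+ 2) = l} ->
  {in `[a, b[, forall l, is_derive l (1 : R) r (dr l)} ->
  {in `[a, b[, continuous dr} ->
  measurable_fun setT f -> (forall l, 0 <= f l) ->
  {in `]a, b[, forall l, f l =
    2 * Num.sqrt 2 * y / (Num.sqrt pi * erfc (Num.sqrt 2 * y)) *
    expR (- (2 * y ^+ 2 * (k ^+ 2 / r l))) * (k / 2 * - dr l / r l `^ (3 / 2))} ->
  (forall l, l \notin `]a, b[ -> f l = 0) ->
  has_density P (g \o S) f.
Proof.
move=> k0 mg gG Gdecr G1 Gb rk Gr dr' cdr mf f0 fab fN.
have inv_sqr_in (s : R) : 1 <= s -> s ^- 2 \in `]0, 1].
  move=> s1; have s0 : 0 < s by exact: lt_le_trans s1.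
  rewrite in_itv/=; apply/andP; split; first by rewrite invr_gt0 exprn_gt0.
  by rewrite invf_le1 ?exprn_gt0// exprn_ege1.
have r0 l : l \in `[a, b[ -> 0 < r l by move=> /rk/andP[].
pose h l := k * r l `^ (- (1 / 2)).
pose dh l := k / 2 * - dr l * r l `^ (- (3 / 2)).
have h_ge0 l : 0 <= h l by rewrite mulr_ge0 ?powR_ge0// ltW.
have h2 l : l \in `[a, b[ -> h l ^+ 2 = k ^+ 2 / r l.
  move=> /r0 rl; rewrite exprMn -[X in _ * X]powR_mulrn ?powR_ge0// -powRrM.
  by rewrite (_ : _ * 2 = - 1) ?powR_inv1 ?ltW//; field.
have h1 l : l \in `[a, b[ -> 1 <= h l.
  move=> lab; rewrite -(@ler_pXn2r _ 2) ?nnegrE// expr1n h2//.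
  by have /andP[r0l rl] := rk _ lab; rewrite ler_pdivlMr// mul1r.
apply: (@has_density_increasing_comp _ _ _ _ _ (fun s =>
  2 * Num.sqrt 2 * y / (Num.sqrt pi * erfc (Num.sqrt 2 * y)) *
  expR (- (2 * y ^+ 2 * s ^+ 2))) _ h dh _ a b 1) => //.
- by move=> x; apply: cvgMl_tmp; exact: continuous_expRNsqr.
- exact: is_S_preimage.
- move=> s t; rewrite !in_itv/= !andbT => s1 t1 st; rewrite !gG//.
  apply: Gdecr; rewrite ?inv_sqr_in//.
  have [s0 t0] : 0 < s /\ 0 < t by split; [exact: lt_le_trans s1|exact: lt_le_trans t1].
  by rewrite ltf_pV2 ?posrE ?exprn_gt0// ltr_pXn2r// nnegrE ltW.
- by rewrite gG// expr1n invr1.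
- move=> s s1; rewrite gG ?ltW//; apply: Gb; rewrite in_itv/=.
  have s0 : 0 < s by exact: lt_trans s1.
  apply/andP; split; first by rewrite invr_gt0 exprn_gt0.
  by rewrite invf_lt1 ?exprn_gt0// exprn_egt1.
- by move=> l lab; rewrite gG ?h1// h2// invf_div Gr.
- move=> l lab; have rl := r0 _ lab; have drl := dr' _ lab.
  have dp := is_derive1_powR (- (1 / 2)) rl.
  have dc : is_derive l (1 : R) ((fun x => x `^ (- (1 / 2))) \o r)
    ((- (1 / 2)) * (r l) `^ (- (1 / 2) - 1) * dr l) by exact: is_derive1_comp.
  apply: is_derive_eq; rewrite /GRing.scale/= /dh.
  rewrite (_ : - (1 / 2) - 1 = - (3 / 2)); last by field.
  by field.
- move=> l lab; have rl := r0 _ lab; have drl := dr' _ lab.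
  apply: cvgM; first by apply: cvgMl_tmp; apply: cvgN; exact: cdr.
  apply: (@continuous_comp _ _ _ r (fun x => x `^ (- (3 / 2)))).
    exact/differentiable_continuous/derivable1_diffP.
  apply/differentiable_continuous/derivable1_diffP.
  by case: (is_derive1_powR (- (3 / 2)) rl).
- move=> l lab; have lab' : l \in `[a, b[ by exact: subset_itv_oo_co lab.
  by rewrite fab// h2// /dh powRN.
Qed.

End truncated_gaussian.

(** * Measurability and sign of the densities; reduction to polynomials in [s ^- 2] *)

Section gammas.
Context {R : realType}.
Implicit Types (l x y : R) (r : R -> R).

Lemma erfc_ge0 x : 0 <= erfc x.
Proof.
rewrite mulr_ge0 ?divr_ge0// ?sqrtr_ge0//.
by apply: Rintegral_ge0 => u _; exact: expR_ge0.
Qed.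

Lemma measurable_expR_div (A : R) r : measurable_fun setT r ->
  measurable_fun setT (fun l => expR (- (A / r l))).
Proof.
move=> mr; apply: measurableT_comp => //; apply: measurableT_comp => //.
by apply: measurable_funM => //; apply: (measurableT_comp measurable_invr).
Qed.

Lemma measurable_powR_comp (p : R) r : measurable_fun setT r ->
  measurable_fun setT (fun l => r l `^ p).
Proof. by move=> mr; apply: (measurableT_comp (measurable_powR p)). Qed.

Lemma measurable_div (f r : R -> R) : measurable_fun setT f ->
  measurable_fun setT r -> measurable_fun setT (fun l => f l / r l).
Proof.
by move=> mf mr; apply: measurable_funM => //; apply: (measurableT_comp measurable_invr).
Qed.

Lemma measurable_sqrt_addl (c : R) : measurable_fun setT (fun l => Num.sqrt (c + l)).
Proof.
apply: continuous_measurable_fun => l; apply: continuous_comp.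
  by apply: cvgD; [exact: cvg_cst|exact: cvg_id].
exact: sqrt_continuous.
Qed.

Lemma measurable_gamma2 y : measurable_fun setT (gamma2 y).
Proof.
have mr : measurable_fun setT (fun l : R => 3 - l) by exact: measurable_funB.
apply: measurable_funM; last exact: measurable_indic.
apply: measurable_funM => //; apply: measurable_div.
  exact: measurable_expR_div.
exact: measurable_powR_comp.
Qed.

Lemma measurable_gamma3 y : measurable_fun setT (gamma3 y).
Proof.
have mr : measurable_fun setT (fun l : R => 15 - l) by exact: measurable_funB.
apply: measurable_funM; last exact: measurable_indic.
apply: measurable_funM => //; apply: measurable_div.
  exact: measurable_expR_div.
exact: measurable_powR_comp.
Qed.

Lemma measurable_gamma4 y : measurable_fun setT (gamma4 y).
Proof.
have mR := measurable_sqrt_addl 120.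
have mr : measurable_fun setT (fun l : R => 15 - Num.sqrt (120 + l)).
  exact: measurable_funB.
apply: measurable_funM; last exact: measurable_indic.
apply: measurable_funM => //; apply: measurable_div.
  exact: measurable_expR_div.
by apply: measurable_funM => //; exact: measurable_powR_comp.
Qed.

Lemma gamma2_ge0 y l : 0 <= gamma2 y l.
Proof.
rewrite /gamma2; apply: mulr_ge0; last by rewrite indicE.
apply: mulr_ge0; apply: divr_ge0; rewrite ?expR_ge0 ?powR_ge0//.
by apply: mulr_ge0; rewrite ?erfc_ge0.
Qed.

Lemma gamma3_ge0 y l : 0 <= gamma3 y l.
Proof.
rewrite /gamma3; apply: mulr_ge0; last by rewrite indicE.
apply: mulr_ge0; apply: divr_ge0; rewrite ?expR_ge0 ?powR_ge0//.
by apply: mulr_ge0; rewrite ?erfc_ge0.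
Qed.

Lemma gamma4_ge0 y l : 0 <= gamma4 y l.
Proof.
rewrite /gamma4; apply: mulr_ge0; last by rewrite indicE.
apply: mulr_ge0; apply: divr_ge0; rewrite ?expR_ge0 ?powR_ge0//.
  by apply: mulr_ge0; rewrite ?erfc_ge0.
by apply: mulr_ge0; rewrite ?powR_ge0.
Qed.

(** The deterministic factor of [ell]: [ell q S] is [ell_map q \o S] by conversion, the form on
    which the change of variables acts. *)
Definition ell_map q (s : R) : R := q`!%:R * s ^- q * (legendre q).[s].

Lemma measurable_ell_map q : measurable_fun setT (ell_map q).
Proof.
apply: measurable_funM; last first.
  by apply: continuous_measurable_fun; exact: continuous_horner.
apply: measurable_funM => //.
by apply: (measurableT_comp measurable_invr); exact: measurable_funX.
Qed.

(** The hypothesis keeps [s] away from 0, where the convention for inverses makes the left side 0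
    and the right side 3. *)
Lemma ell_map2E (s : R) : 1 <= s -> ell_map 2 s = 3 - s ^- 2.
Proof.
move=> s1; rewrite /ell_map legendre2E (_ : 2`! = 2%N)//; field.
by rewrite gt_eqF// (lt_le_trans _ s1).
Qed.

Lemma ell_map3E (s : R) : 1 <= s -> ell_map 3 s = 15 - 9 * s ^- 2.
Proof.
move=> s1; rewrite /ell_map legendre3E (_ : 3`! = 6%N)//; field.
by rewrite gt_eqF// (lt_le_trans _ s1).
Qed.

Lemma ell_map4E (s : R) : 1 <= s ->
  ell_map 4 s = 105 - 90 * s ^- 2 + 9 * (s ^- 2) ^+ 2.
Proof.
move=> s1; rewrite /ell_map legendre4E (_ : 4`! = 24%N)//; field.
by rewrite gt_eqF// (lt_le_trans _ s1).
Qed.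

End gammas.

(** * The three densities *)

Section ell_densities.
Context {d : measure_display} {T : measurableType d} {R : realType}.
Context (P : probability T R) (y : R) (S : {RV P >-> R}).
Hypotheses (y0 : 0 < y) (Sy : is_S y S).

(** Here [u = 3 - l] and [k = 1]; the support runs from the value 2 at [u = 1] to the value 3 at
    [u = 0]. *)
Lemma has_density_ell2 : has_density P (ell 2 S) (gamma2 y).
Proof.
apply: (@has_density_decreasing_inv_sqr _ _ _ _ _ _ y0 Sy (ell_map 2)
  (fun u => 3 - u) (fun l => 3 - l) (fun=> - 1) _ 2 3 1) => //.
- exact: measurable_ell_map.
- exact: ell_map2E.
- by move=> u v _ _; rewrite ltrD2l ltrN2.
- by ring.
- by move=> u; rewrite in_itv/= => /andP[u0 _]; lra.
- by move=> l; rewrite in_itv/= => /andP[l2 l3]; rewrite expr1n; apply/andP; split; lra.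
- by move=> l _ /=; field.
- by move=> l _; apply: is_derive_eq; rewrite add0r mul1r.
- by move=> l _; exact: cvg_cst.
- exact: measurable_gamma2.
- by move=> l; exact: gamma2_ge0.
- move=> l lab; rewrite /gamma2 indicE mem_set// mulr1 gtr0_norm// expr1n mulrA.
  rewrite mulr1.
  (* Naming the inverses of the transcendental factors leaves an identity with numeric denominators
     only. *)
  set E := (_ * erfc _)^-1; set W := (_ `^ _)^-1; set X := expR _.
  by field.
- by move=> l lab; rewrite /gamma2 indicE memNset ?mulr0//; exact/negP.
Qed.

(** Here [u = (15 - l) / 9], whence [k = 3]; the values at [u = 1] and [u = 0] are 6 and 15. *)
Lemma has_density_ell3 : has_density P (ell 3 S) (gamma3 y).
Proof.
apply: (@has_density_decreasing_inv_sqr _ _ _ _ _ _ y0 Sy (ell_map 3)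
  (fun u => 15 - 9 * u) (fun l => 15 - l) (fun=> - 1) _ 6 15 3) => //.
- exact: measurable_ell_map.
- exact: ell_map3E.
- by move=> u v _ _ uv; lra.
- by ring.
- by move=> u; rewrite in_itv/= => /andP[u0 _]; lra.
- by move=> l; rewrite in_itv/= => /andP[l2 l3]; apply/andP; split; lra.
- by move=> l _ /=; field.
- by move=> l _; apply: is_derive_eq; rewrite add0r mul1r.
- by move=> l _; exact: cvg_cst.
- exact: measurable_gamma3.
- by move=> l; exact: gamma3_ge0.
- move=> l lab; rewrite /gamma3 indicE mem_set// mulr1 gtr0_norm//.
  rewrite (_ : 2 * y ^+ 2 * (3 ^+ 2 / _) = 18 * y ^+ 2 / (15 - l)); last by ring.
  set E := (_ * erfc _)^-1; set W := (_ `^ _)^-1; set X := expR _.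
  by field.
- by move=> l lab; rewrite /gamma3 indicE memNset ?mulr0//; exact/negP.
Qed.

(** Solving the quadratic for [u] and keeping the root in []0, 1]] gives
    [u = (15 - sqrt (120 + l)) / 3], whence [k = sqrt 3]. *)
Lemma has_density_ell4 : has_density P (ell 4 S) (gamma4 y).
Proof.
have k2 : Num.sqrt 3 ^+ 2 = 3 :> R by rewrite sqr_sqrtr.
(* At the ends of the support [120 + l] is 144 and 225, the squares of 12 and 15. *)
have rho l : 24 <= l < 105 -> [/\ 12 <= Num.sqrt (120 + l), Num.sqrt (120 + l) < 15
    & Num.sqrt (120 + l) ^+ 2 = 120 + l].
  move=> /andP[l1 l2].
  rewrite sqr_sqrtr; last lra.
  split=> //.
    rewrite -(@ler_pXn2r _ 2) ?nnegrE// sqr_sqrtr; lra.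
  rewrite -(@ltr_pXn2r _ 2) ?nnegrE// sqr_sqrtr; lra.
apply: (@has_density_decreasing_inv_sqr _ _ _ _ _ _ y0 Sy (ell_map 4)
  (fun u => 105 - 90 * u + 9 * u ^+ 2) (fun l => 15 - Num.sqrt (120 + l))
  (fun l => - (2 * Num.sqrt (120 + l))^-1) _ 24 105 (Num.sqrt 3)).
- by rewrite sqrtr_gt0.
- exact: measurable_ell_map.
- exact: ell_map4E.
(* The difference of the values at [u] and [v] is [(v - u) * (90 - 9 * (u + v))], and
   [u + v <= 2]. *)
- move=> u v; rewrite !in_itv/= => /andP[u0 u1] /andP[v0 v1] uv; nra.
- by ring.
- by move=> u; rewrite in_itv/= => /andP[u0 u1]; nra.
- move=> l; rewrite in_itv/= => /rho[r1 r2 _]; rewrite k2.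
  by apply/andP; split; lra.
(* Completing the square, the polynomial is [(15 - 3 * u) ^+ 2 - 120]. *)
- move=> l; rewrite in_itv/= => /rho[_ _ r2]; rewrite k2.
  transitivity (Num.sqrt (120 + l) ^+ 2 - 120); first by field.
  by rewrite r2; ring.
- move=> l; rewrite in_itv/= => /andP[l1 l2].
  have l0 : 0 < 120 + l by lra.
  have ds := is_derive1_sqrt l0.
  have da : is_derive l (1 : R) (fun l => 120 + l) 1.
    by apply: is_derive_eq; rewrite add0r mul1r.
  have dc : is_derive l (1 : R) (Num.sqrt \o (fun l => 120 + l))
    ((2 * Num.sqrt (120 + l))^-1 * 1) by exact: is_derive1_comp.
  by apply: is_derive_eq; rewrite add0r mul1r mulr1.
- move=> l; rewrite in_itv/= => /rho[r1 r2 _].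
  apply: cvgN; apply: cvgV; first by rewrite mulf_neq0// gt_eqF//; lra.
  apply: cvgMl_tmp; apply: continuous_comp; last exact: sqrt_continuous.
  by apply: cvgD; [exact: cvg_cst|exact: cvg_id].
- exact: measurable_gamma4.
- by move=> l; exact: gamma4_ge0.
- move=> l lab; rewrite /gamma4 indicE mem_set// mulr1 gtr0_norm// k2.
  rewrite (_ : 2 * y ^+ 2 * (3 / _) = 6 * y ^+ 2 / (15 - Num.sqrt (120 + l))); last by ring.
  (* The factor [sqrt 3] of [sqrt 6] is [k]; the 2 in the denominator of the constant comes from the
     derivative of the square root. *)
  have -> : Num.sqrt 6 = Num.sqrt 2 * Num.sqrt 3 :> R.
    by rewrite -sqrtrM// -natrM.
  rewrite -[2 * _ * erfc _]mulrA !(invfM 2) (invfM (Num.sqrt (120 + l))).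
  set E := (_ * erfc _)^-1; set W := (_ `^ _)^-1; set X := expR _.
  set Z := (Num.sqrt (120 + l))^-1.
  by field.
- by move=> l lab; rewrite /gamma4 indicE memNset ?mulr0//; exact/negP.
Qed.

End ell_densities.

Theorem corollary2p3 (R : realType) (d : measure_display)
    (T : measurableType d) (P : probability T R) (y : R) (S : {RV P >-> R}) :
  0 < y -> is_S y S ->
  [/\ has_density P (ell 2 S) (gamma2 y),
      has_density P (ell 3 S) (gamma3 y)
    & has_density P (ell 4 S) (gamma4 y)].
Proof.
move=> y0 Sy; split; [exact: has_density_ell2|exact: has_density_ell3|].
exact: has_density_ell4.
Qed.
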